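(* For $s-q=1$, the Hadamard bound for the Data-Fusion problem is exact: $\mathfrak{z}_{\mathcal{H}}=\mathfrak{z}$, where $\mathfrak{z}$ is the optimal value of the Data-Fusion problem.
   Context: Let $G\in\mathbb{R}^{p\times m}$, $H\in\mathbb{R}^{q\times m}$, $B:=H^\top H$ positive definite, $P:=\{1,\dots,p\}$, and $s$ an integer with $0<s-q<p$. The Data-Fusion problem is $\mathfrak{z}:=\max\{\operatorname{ldet}(B+G^\top\operatorname{Diag}(x)G):\mathbf{e}^\top x=s-q,\ x\in\{0,1\}^p\}$, where $\operatorname{ldet}$ is log-determinant, $\mathbf{e}$ the all-ones vector, $\operatorname{Diag}(x)$ the diagonal matrix with diagonal $x$. Hadamard bound: let $LL^\top$ be the Cholesky factorization of $B$, let $\rho_i(GL^{-\top}):=\|G_{i\cdot}L^{-\top}\|_2$ for $i\in P$ ($G_{i\cdot}$ is row $i$ of $G$), and let $\tau$ be a bijection from $\{1,\dots,p\}$ to $P$ such that $\rho_{\tau(i)}(GL^{-\top})\ge\rho_{\tau(j)}(GL^{-\top})$ whenever $i\le j$. Then $\mathfrak{z}_{\mathcal{H}}:=\operatorname{ldet}(B)+\sum_{i=1}^{s-q}\log\big(1+\rho_{\tau(i)}^2(GL^{-\top})\big)$. *)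

(* Defs.v *)
From HB Require Import structures.
From mathcomp Require Import all_boot all_order all_algebra.
From mathcomp Require Import all_fingroup.
From mathcomp Require Import all_classical all_reals all_analysis.

Set Implicit Arguments.
Unset Strict Implicit.
Unset Printing Implicit Defensive.

Import Order.TTheory GRing.Theory Num.Theory.
Local Open Scope classical_set_scope.
Local Open Scope ring_scope.

Definition posdef (R : realType) (m : nat) (A : 'M[R]_m) : Prop :=
  A^T = A /\ forall v : 'cV[R]_m, v != 0 -> 0 < (v^T *m A *m v) 0 0.

(* [is_trig_mx L] means that [L] is lower triangular. *)
Definition cholesky (R : realType) (m : nat) (A L : 'M[R]_m) : Prop :=
  [/\ is_trig_mx L, (forall i, 0 < L i i) & L *m L^T = A].

(* [ln] is total; it is only evaluated at positive determinants when [A] is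
   positive definite. *)
Definition ldet (R : realType) (m : nat) (A : 'M[R]_m) : R := ln (\det A).

(* The norm provided by the library on matrices is the max norm. *)
Definition norm2 (R : realType) (m : nat) (v : 'rV[R]_m) : R :=
  Num.sqrt (\sum_(j < m) v 0 j ^+ 2).

Section DataFusion.
Variables (R : realType) (p q m : nat) (G : 'M[R]_(p, m)) (H : 'M[R]_(q, m)).
Variable s : nat.

Definition fusion_B : 'M[R]_m := H^T *m H.

(* Subtraction of naturals is truncated: these definitions are meant to be used
   under [0 < s - q], which forces [q < s]. *)
Definition fusion_feasible : set 'cV[R]_p :=
  [set x | ((const_mx 1 : 'cV[R]_p)^T *m x) 0 0 = (s - q)%:R /\
           forall i, x i 0 = 0 \/ x i 0 = 1].

Definition fusion_obj (x : 'cV[R]_p) : R :=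
  ldet (fusion_B + G^T *m diag_mx x^T *m G).

(* The feasible set is finite, and nonempty when [s - q <= p]; this supremum is
   then a maximum, see [fusion_opt_max]. *)
Definition fusion_opt : R := sup (fusion_obj @` fusion_feasible).

Definition rho (A : 'M[R]_(p, m)) (i : 'I_p) : R := norm2 (row i A).

Definition rho_sorting (A : 'M[R]_(p, m)) (tau : {perm 'I_p}) : Prop :=
  forall i j : 'I_p, (i <= j)%N -> rho A (tau j) <= rho A (tau i).

Definition hadamard_bound (L : 'M[R]_m) (tau : {perm 'I_p}) : R :=
  ldet fusion_B +
  \sum_(i < p | (i < s - q)%N) ln (1 + rho (G *m invmx L^T) (tau i) ^+ 2).

Lemma fusion_opt_max : (s - q <= p)%N ->
  (exists2 x, fusion_feasible x & fusion_obj x = fusion_opt) /\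
  (forall x, fusion_feasible x -> fusion_obj x <= fusion_opt).
Proof.
move=> skp.
pose c (f : {ffun 'I_p -> bool}) : 'cV[R]_p := \col_i (f i)%:R.
have sumE (x : 'cV[R]_p) :
    ((const_mx 1 : 'cV[R]_p)^T *m x) 0 0 = \sum_i x i 0.
  by rewrite mxE; apply: eq_bigr => i _; rewrite !mxE mul1r.
pose P f := `[< fusion_feasible (c f) >].
pose f0 : {ffun 'I_p -> bool} := [ffun i : 'I_p => (i < s - q)%N].
have Pf0 : P f0.
  apply/asboolP; split; last first.
    by move=> i; rewrite mxE; case: (f0 i); [right|left].
  rewrite sumE (eq_bigr (fun i : 'I_p => if (i < s - q)%N then 1 else 0)).
    rewrite -big_mkcond /= -(big_ord_widen p (fun=> 1 : R)) //.
    by rewrite sumr_const card_ord.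
  by move=> i _; rewrite !mxE ffunE; case: ifP.
have cE x : fusion_feasible x -> exists2 f, P f & x = c f.
  move=> Fx; have xE : x = c [ffun i => x i 0 == 1].
    apply/matrixP => i j; rewrite ord1 !mxE ffunE.
    by case: (Fx.2 i) => ->; rewrite ?eqxx // eq_sym oner_eq0.
  by exists [ffun i => x i 0 == 1] => //; apply/asboolP; rewrite -xE.
case: (arg_maxP (fun f => fusion_obj (c f)) Pf0) => f /asboolP Pf fmax.
have ubf x : fusion_feasible x -> fusion_obj x <= fusion_obj (c f).
  by move=> /cE[g Pg ->]; apply: fmax.
suff E : fusion_opt = fusion_obj (c f) by split; [exists (c f)|rewrite E].
apply/eqP; rewrite eq_le; apply/andP; split.
  apply: ge_sup; first by exists (fusion_obj (c f)), (c f).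
  by move=> _ [x Fx <-]; apply: ubf.
apply: ub_le_sup; last by exists (c f).
by exists (fusion_obj (c f)) => _ [x Fx <-]; apply: ubf.
Qed.

End DataFusion.

(* Main.v *)
Require Import Defs.
From HB Require Import structures.
From mathcomp Require Import all_boot all_order all_algebra.
From mathcomp Require Import all_fingroup.
From mathcomp Require Import all_classical all_reals all_analysis.

Import Order.TTheory GRing.Theory Num.Theory.
Local Open Scope ring_scope.

(* The feasible points are the unit vectors, at which the objective involves a
   rank-one update of [B = L L^T]. By Sylvester's determinant identity
   [det (L L^T + g^T g) = det B * (1 + |g L^-T|^2)], so the optimal value is
   attained at a row [g] of [G] maximizing [|g L^-T|]. *)

Lemma sylvester_det (R : comPzRingType) (m n : nat)
    (A : 'M[R]_(m, n)) (B : 'M[R]_(n, m)) :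
  \det (1%:M + A *m B) = \det (1%:M + B *m A).
Proof.
(* The factor [U] is unipotent. Both [U *m M] and [M *m U] are block lower triangular, and their
   determinants are the two sides of the identity. *)
pose M := block_mx 1%:M (- A) B 1%:M.
pose U := block_mx 1%:M A (0 : 'M[R]_(n, m)) 1%:M.
have UM : U *m M = block_mx (1%:M + A *m B) 0 B 1%:M.
  by rewrite mulmx_block !mul1mx !mul0mx !mulmx1 !add0r addNr.
have MU : M *m U = block_mx 1%:M 0 B (1%:M + B *m A).
  by rewrite mulmx_block !mul1mx !mulmx1 !mulmx0 !addr0 addrN addrC.
apply/esym; have := det_mulmx M U.
by rewrite mulrC -det_mulmx UM MU !det_lblock !det1 mul1r mulr1.
Qed.

Lemma norm2_sqr (R : realType) (m : nat) (v : 'rV[R]_m) :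
  norm2 v ^+ 2 = (v *m v^T) 0 0.
Proof.
rewrite sqr_sqrtr; last by apply: sumr_ge0 => j _; apply: sqr_ge0.
by rewrite mxE; apply: eq_bigr => j _; rewrite mxE expr2.
Qed.

Lemma det_cholesky_gt0 {R : realType} {m : nat} {A L : 'M[R]_m} :
  cholesky A L -> 0 < \det L.
Proof. by case=> Ltrig Lpos _; rewrite det_trig // prodr_gt0. Qed.

(** With [h = g *m invmx L^T], the updated matrix factors as [L *m (1%:M + h^T *m h) *m L^T];
    Sylvester's identity reduces the middle determinant to that of the 1 by 1 matrix
    [1%:M + h *m h^T]. *)
Lemma det_cholesky_rank1 {R : realType} {m : nat} {A L : 'M[R]_m}
    (g : 'rV[R]_m) : cholesky A L ->
  \det (A + g^T *m g) = \det A * (1 + norm2 (g *m invmx L^T) ^+ 2).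
Proof.
move=> cAL; have Lu : L \in unitmx.
  by rewrite unitmxE unitfE gt_eqF // (det_cholesky_gt0 cAL).
case: cAL => _ _ <-.
have LTu : L^T \in unitmx by rewrite unitmx_tr.
set h := g *m invmx L^T.
have gE : g = h *m L^T by rewrite mulmxKV.
have -> : L *m L^T + g^T *m g = L *m (1%:M + h^T *m h) *m L^T.
  by rewrite mulmxDr mulmxDl mulmx1 gE trmx_mul trmxK !mulmxA.
rewrite !det_mulmx sylvester_det [\det (1%:M + _)]det_mx11 norm2_sqr.
by rewrite [in LHS]mxE [1%:M 0 0]mxE mulrAC.
Qed.

Lemma fusion_obj_delta {R : realType} {p q m : nat} (G : 'M[R]_(p, m))
    {H : 'M[R]_(q, m)} {L : 'M[R]_m} (i : 'I_p) :
  cholesky (fusion_B H) L ->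
  fusion_obj G H (delta_mx i 0) =
  ldet (fusion_B H) + ln (1 + rho (G *m invmx L^T) i ^+ 2).
Proof.
move=> cL; rewrite /fusion_obj /ldet.
(* The diagonal matrix of a unit vector is [delta_mx i i], the product of a unit column and a unit
   row, which select row [i] of [G] on both sides. *)
have -> : G^T *m diag_mx (delta_mx i 0)^T *m G = (row i G)^T *m row i G.
  rewrite rowE trmx_mul !trmx_delta mulmxA -[X in _ = X *m G]mulmxA.
  rewrite mul_delta_mx; congr (_ *m _ *m _); apply/matrixP => j k.
  rewrite !mxE; have [->|jk] := eqVneq j k; first by rewrite andbb.
  by rewrite mulr0n; case: (eqVneq j i) jk => // ->; rewrite eq_sym => /negPf ->.
(* The logarithm splits because both factors are positive; the first one is the square of
   [\det L]. *)
rewrite (det_cholesky_rank1 _ cL) /rho row_mul lnM // posrE.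
- by case: (cL) => _ _ <-; rewrite det_mulmx det_tr mulr_gt0 ?(det_cholesky_gt0 cL).
- by rewrite ltr_wpDr ?sqr_ge0.
Qed.

Lemma fusion_feasible1 {R : realType} {p q s : nat} (x : 'cV[R]_p) :
  (s - q = 1)%N ->
  fusion_feasible q s x <-> exists i, x = delta_mx i 0.
Proof.
move=> sq1; rewrite /fusion_feasible /= sq1.
have -> : ((const_mx 1 : 'cV[R]_p)^T *m x) 0 0 = \sum_i x i 0.
  by rewrite mxE; apply: eq_bigr => i _; rewrite !mxE mul1r.
split=> [[sx x01]|[i ->]]; last first.
  split=> [|j]; last by rewrite mxE eqxx andbT; case: eqP; [right|left].
  by rewrite (bigD1 i) //= big1 ?mxE ?eqxx ?addr0 // => j /negPf ji; rewrite mxE ji.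
(* If no entry were 1, all would be 0 and the sum could not be 1. *)
have [i xi] : exists i, x i 0 = 1.
  apply: contrapT => /forallNP nx1; move/eqP: sx.
  rewrite big1 ?(eq_sym 0) ?oner_eq0 // => j _.
  by case: (x01 j) => // /nx1.
exists i; apply/matrixP => j k; rewrite ord1 mxE eqxx andbT.
case: eqVneq => [->//|ji].
(* The entry at [i] uses up the whole sum; the other entries are nonnegative with sum 0, so each
   vanishes. *)
have s0 : \sum_(k < p | k != i) x k 0 = 0.
  by move: sx; rewrite (bigD1 i) //= xi -[RHS]addr0 => /addrI.
by apply: (psumr_eq0P _ s0) => // l _; case: (x01 l) => ->.
Qed.

Theorem theorem18 (R : realType) (p q m s : nat)
    (G : 'M[R]_(p, m)) (H : 'M[R]_(q, m))
    (HB : posdef (fusion_B H)) (Hs : (0 < s - q < p)%N)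
    (L : 'M[R]_m) (HL : cholesky (fusion_B H) L)
    (tau : {perm 'I_p}) (Htau : rho_sorting (G *m invmx L^T) tau)
    (Hs1 : (s - q = 1)%N) :
  hadamard_bound G H s L tau = fusion_opt G H s.
Proof.
case/andP: Hs => s0 sp; pose i0 : 'I_p := Ordinal (ltn_trans s0 sp).
(* Only position 0 satisfies [i < 1], so the bound is the objective at the row that [tau] ranks
   first. *)
have -> : hadamard_bound G H s L tau = fusion_obj G H (delta_mx (tau i0) 0).
  rewrite (fusion_obj_delta G _ HL) /hadamard_bound (big_pred1 i0) // => i.
  by rewrite Hs1 ltnS leqn0.
have [[x /(fusion_feasible1 _ Hs1)[i ->] <-] ub] := fusion_opt_max G H (ltnW sp).
(* One inequality is feasibility of the unit vector at [tau i0]; the other compares the optimal row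
   [i] with row [tau i0]. *)
apply/eqP; rewrite eq_le ub; last by apply/(fusion_feasible1 _ Hs1); exists (tau i0).
have rho_ge0 j : 0 <= rho (G *m invmx L^T) j by apply: sqrtr_ge0.
rewrite !(fusion_obj_delta G _ HL) lerD2l ler_ln ?posrE ?ltr_wpDr ?sqr_ge0 //.
(* Writing [i] as the image under [tau] of its position lets the sorting hypothesis apply, since
   [i0] precedes every position. *)
by rewrite lerD2l lerXn2r ?nnegrE // -[i](permKV tau) Htau.
Qed.
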